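(* Let $d$ be a positive integer and let $v_1,\ldots,v_d\in\mathbb{Z}^2$ be a sequence of primitive vectors, with the cyclic convention $v_0=v_d$, $v_{d+1}=v_1$, such that $\varepsilon_i=\det(v_i,v_{i+1})\neq 0$ for all $i=1,\ldots,d$ (and $\varepsilon_0=\varepsilon_d$). Let $a_i=\varepsilon_{i-1}^{-1}\varepsilon_i^{-1}\det(v_{i+1},v_{i-1})$ for $i=1,\ldots,d$, and let $x_i,y_i,l_i,n^{(i)}_j$ be the integers attached to the sequence as defined in the context. Then the rotation number of the sequence $v_1,\ldots,v_d$ around the origin equals $$\frac{1}{12}\sum_{i=1}^d\left(\left(3(l_i+1)-\sum_{j=1}^{l_i}n^{(i)}_j\right)\frac{\varepsilon_i}{|\varepsilon_i|}+a_i-\frac{x_i+y_i}{\varepsilon_i}\right).$$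
   Context: A vector in $\mathbb{Z}^2$ is primitive if its components are relatively prime. Vectors are columns; $(v,w)$ denotes the $2\times 2$ matrix with columns $v,w$, and $\det(v,w)$ its determinant. A unimodular matrix is an integer matrix with determinant $\pm1$. Rotation number: for a sequence $v_1,\ldots,v_d$ as in the claim, the rotation number around the origin is $$\frac{1}{2\pi}\sum_{i=1}^d\int_{L_i}\frac{-y\,dx+x\,dy}{x^2+y^2},$$ where $L_i$ is the line segment from $v_i$ to $v_{i+1}$. The integers $x_i,y_i$: for each $i$, $x_i$ is the unique non-negative integer with $x_i<|\varepsilon_i|$, relatively prime to $|\varepsilon_i|$, such that $$P_i=(v_i,v_{i+1})\begin{pmatrix}1&-x_i\\0&|\varepsilon_i|\end{pmatrix}^{-1}$$ is a unimodular matrix; $y_i$ is the unique non-negative integer with $y_i<|\varepsilon_i|$ such that $$Q_i=(v_{i+1},v_i)\begin{pmatrix}1&-y_i\\0&|\varepsilon_i|\end{pmatrix}^{-1}$$ is a unimodular matrix. (These exist and are unique; $x_i>0$ if $|\varepsilon_i|\ge 2$, and $x_i=0$ if $|\varepsilon_i|=1$.) The integers $l_i,n^{(i)}_j$: if $|\varepsilon_i|\geq 2$, then $l_i\ge 1$ and $n^{(i)}_1,\ldots,n^{(i)}_{l_i}\ge 2$ are the integers given by the (unique) Hirzebruch-Jung continued fraction expansion $$\frac{|\varepsilon_i|}{x_i}=n^{(i)}_1-\cfrac{1}{n^{(i)}_2-\cfrac{1}{\ddots-\cfrac{1}{n^{(i)}_{l_i}}}},\qquad n^{(i)}_j\geq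 2.$$ If $|\varepsilon_i|=1$, then $l_i=0$ (and there are no $n^{(i)}_j$). *)

(* Defs.v *)
(* MathComp / MathComp-Analysis *)
From HB Require Import structures.
From mathcomp Require Import all_boot all_order all_algebra.
From mathcomp Require Import all_classical all_reals all_analysis.
Set Implicit Arguments.
Unset Strict Implicit.
Unset Printing Implicit Defensive.
Import Order.TTheory GRing.Theory Num.Theory.
Local Open Scope ring_scope.

Definition primitive (v : 'cV[int]_2) : bool := coprimez (v 0 0) (v 1 0).

Definition columns (K : Type) (v w : 'cV[K]_2) : 'M[K]_2 :=
  row_mx v w : 'M[K]_(2, 1 + 1).

Definition det2 (v w : 'cV[int]_2) : int := \det (columns v w).

(* The inverse matrices in the definition of x_i, y_i live over the rationals,
   so a unimodular matrix is a rational one with integer entries. *)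
Definition unimodular (A : 'M[rat]_2) : bool :=
  (A \is a mxOver Num.int) && (`|\det A| == 1).

(* The matrix with rows (1, -x) and (0, m). *)
Definition shear_mx (x m : nat) : 'M[rat]_2 :=
  block_mx 1%:M (- x%:R)%:M 0 m%:R%:M : 'M[rat]_(1 + 1, 1 + 1).

Definition normalized (v w : 'cV[int]_2) (x m : nat) : 'M[rat]_2 :=
  map_mx intr (columns v w) *m invmx (shear_mx x m).

(* The value of m - 1/(m_1 - 1/(... - 1/m_k)), where s = [:: m_1; ...; m_k]. *)
Fixpoint hj_value_from (m : int) (s : seq int) : rat :=
  match s with
  | [::] => m%:~R
  | m1 :: s' => m%:~R - (hj_value_from m1 s')^-1
  end.

Definition hj_expansion (q : rat) (s : seq int) : Prop :=
  match s with
  | [::] => False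
  | m :: s' => (forall k, k \in s -> 2 <= k) /\ hj_value_from m s' = q
  end.

(* Indices 1, ..., d are represented by 'I_d, read cyclically: ordS i is i + 1
   and ord_pred i is i - 1 modulo d. *)
Section Sequence.
Context (d : nat) (v : 'I_d -> 'cV[int]_2).

Definition eps (i : 'I_d) : int := det2 (v i) (v (ordS i)).

Definition is_x (i : 'I_d) (x : nat) : Prop :=
  [/\ (x < `|eps i|)%N, coprime x `|eps i|
    & unimodular (normalized (v i) (v (ordS i)) x `|eps i|)].

Definition is_y (i : 'I_d) (y : nat) : Prop :=
  (y < `|eps i|)%N /\
  unimodular (normalized (v (ordS i)) (v i) y `|eps i|).

(* s = [:: n_1; ...; n_l] for the index i, whence l = size s. *)
Definition is_hj_seq (i : 'I_d) (x : nat) (s : seq int) : Prop :=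
  ((2 <= `|eps i|)%N -> hj_expansion (`|eps i|%:R / x%:R) s) /\
  (`|eps i|%N = 1%N -> s = [::]).

Definition a_coef (K : fieldType) (i : 'I_d) : K :=
  (eps (ord_pred i))%:~R^-1 * (eps i)%:~R^-1
  * (det2 (v (ordS i)) (v (ord_pred i)))%:~R.

End Sequence.

Section RotationNumber.
Context (R : realType).

(* The integral of p dx + q dy along the segment from A to B, parametrized by
   t |-> (1 - t) A + t B, whose velocity is B - A. *)
Definition segment_integral (p q : R -> R -> R) (A B : 'cV[R]_2) : R :=
  let g (t : R) : 'cV[R]_2 := (1 - t) *: A + t *: B in
  \int[@lebesgue_measure R]_(t in `[0, 1])
    (p (g t 0 0) (g t 1 0) * (B - A) 0 0
     + q (g t 0 0) (g t 1 0) * (B - A) 1 0).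

Definition rotation_number (d : nat) (v : 'I_d -> 'cV[int]_2) : R :=
  (2 * pi)^-1 * \sum_(i < d)
    segment_integral (fun x y => - y / (x ^+ 2 + y ^+ 2))
                     (fun x y => x / (x ^+ 2 + y ^+ 2))
                     (map_mx intr (v i)) (map_mx intr (v (ordS i))).

End RotationNumber.

(* Main.v *)
(* The form dtheta has the antiderivative atan along a segment, so the angle of
   an edge (v, w) is a coboundary plus (pi/2) s (1 - side v * side w), where
   s = sgn det(v, w) and side is the half-plane sign: the rotation number is the
   sum of s (1 - side v * side w) / 4 over the edges.

   On the arithmetic side one chooses for every primitive v a vector v' with
   det(v, v') = 1.  By the Pluecker relation,
     a_i = - det(v_{i+1}, v_i') / eps_i - det(v_{i-1}, v_i') / eps_{i-1},
   so the right-hand side also becomes a sum over the edges.  The two sums agree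
   edge by edge if the v' are such that
     det(w, v') + det(v, w') = 3 side v * side w   whenever |det(v, w)| = 1.
   The Euclidean algorithm produces such a choice: the constraints between
   p + q and its parents p, q determine (p + q)' and are consistent with
   det(p + q, (p + q)') = 1.  Edges with |eps| > 1 are handled by subdividing
   the cone of (v, w) along its Hirzebruch-Jung expansion, starting at the lattice
   vector (x v + w) / |eps|; both sides are additive under this subdivision. *)
Require Import Defs.
From mathcomp Require Import all_boot all_order all_algebra.
From mathcomp Require Import all_classical all_reals all_analysis.
From mathcomp Require Import zify ring lra.
Set Implicit Arguments.
Unset Strict Implicit.
Unset Printing Implicit Defensive.
Import Order.TTheory GRing.Theory Num.Theory.
Import numFieldNormedType.Exports.
Local Open Scope ring_scope.

(** * Determinants of pairs of columns *)

Lemma columnsE0 (K : Type) (v w : 'cV[K]_2) i : columns v w i 0 = v i 0.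
Proof.
by rewrite -(row_mxEl v w i 0); congr fun_of_matrix; apply/val_inj.
Qed.

Lemma columnsE1 (K : Type) (v w : 'cV[K]_2) i : columns v w i 1 = w i 0.
Proof.
by rewrite -(row_mxEr v w i 0); congr fun_of_matrix; apply/val_inj.
Qed.

Lemma det_mx2 (K : comPzRingType) (A : 'M[K]_2) : \det A = A 0 0 * A 1 1 - A 1 0 * A 0 1.
Proof.
have l00 : lift 0 0 = 1 :> 'I_2 by apply/val_inj.
have l10 : lift 1 0 = 0 :> 'I_2 by apply/val_inj.
rewrite (expand_det_col _ 0) !big_ord_recl big_ord0 addr0 l00.
by rewrite /cofactor !det_mx11 !mxE l00 l10 expr0 expr1 mul1r mulN1r mulrN.
Qed.

Lemma det2E (v w : 'cV[int]_2) : det2 v w = v 0 0 * w 1 0 - v 1 0 * w 0 0.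
Proof. by rewrite /det2 det_mx2 !columnsE0 !columnsE1. Qed.



(** * Dual vectors inside a unimodular cone *)

(* In a cone spanned by p, q with det(p, q) = 1 and k = det(q, p'): the
   coordinates on (p, q) of the vector dual to a p + b q.  The relation
   det(q, p') + det(p, q') = 3 forces p' = - k p + q and q' = - p + (3 - k) q;
   passing to the cone (p, p + q) or (p + q, q) changes k to k + 1 or k - 1.
   The argument f is fuel and must exceed a + b. *)
Fixpoint cone_dual_rec (f a b : nat) (k : int) : int * int :=
  if f is f'.+1 then
    if b == 0%N then (- k, 1)
    else if a == 0%N then (- 1, 3 - k)
    else if (b <= a)%N then
      let c := cone_dual_rec f' (a - b) b (k + 1) in (c.1 + c.2, c.2)
    else let c := cone_dual_rec f' a (b - a) (k - 1) in (c.1, c.1 + c.2)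
  else (0, 0).

Definition cone_dual (a b : nat) := cone_dual_rec (a + b).+1 a b.

Lemma cone_dual_recE (f a b : nat) (k : int) :
  (a + b < f)%N -> cone_dual_rec f a b k = cone_dual a b k.
Proof.
suff fuel g : (a + b < f)%N -> (a + b < g)%N ->
    cone_dual_rec f a b k = cone_dual_rec g a b k.
  by move=> hf; exact: fuel.
elim: f g a b k => [|f IH] [|g] a b k //= hf hg.
case: (boolP (b == 0%N)) => // b0; case: (boolP (a == 0%N)) => // a0.
by case: (leqP b a) => h; rewrite (IH g) //; lia.
Qed.

Lemma cone_dual0l k : cone_dual 0 1 k = (- 1, 3 - k). Proof. by []. Qed.
Lemma cone_dual0r k : cone_dual 1 0 k = (- k, 1). Proof. by []. Qed.

(** The recursion persists at [b = 0]: coprimality then forces [a = 1], and the sum of the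
    coordinates absorbs the change of [k]. *)
Lemma cone_dual_left (a b : nat) (k : int) : coprime a b -> (b <= a)%N ->
  cone_dual a b k = let c := cone_dual (a - b) b (k + 1) in (c.1 + c.2, c.2).
Proof.
case: (eqVneq b 0%N) => [->|b0]; first by rewrite /coprime gcdn0 => /eqP-> _ /=; congr (_, _); ring.
case: (eqVneq a 0%N) => [->|a0]; first by case: b b0.
move=> _ h; rewrite {1}/cone_dual /= (negPf a0) (negPf b0) h.
by rewrite cone_dual_recE //; lia.
Qed.

(** The definition sends [a = b] to the other branch. Coprimality leaves only [a = b = 1], where
    both branches give [(1 - k, 2 - k)]: the two subcones agree on the dual vector of p + q. *)
Lemma cone_dual_right (a b : nat) (k : int) : coprime a b -> (a <= b)%N ->
  cone_dual a b k = let c := cone_dual a (b - a) (k - 1) in (c.1, c.1 + c.2).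
Proof.
case: (eqVneq a 0%N) => [->|a0].
  by rewrite /coprime gcd0n => /eqP-> _; rewrite !cone_dual0l /=; congr (_, _); ring.
case: (eqVneq b 0%N) => [->|b0]; first by case: a a0.
move=> cop; rewrite leq_eqVlt => /predU1P[eab|h].
  move: cop; rewrite -{}eab /coprime gcdnn => /eqP->.
  by rewrite subnn /cone_dual /=; congr (_, _); ring.
rewrite {1}/cone_dual /= (negPf a0) (negPf b0) leqNgt h /=.
by rewrite cone_dual_recE //; lia.
Qed.

(** Each recursion step applies one shear to [(a, b)] and to its dual vector, which preserves their
    determinant. *)
Lemma cone_dual_det (a b : nat) (k : int) : coprime a b ->
  a%:Z * (cone_dual a b k).2 - b%:Z * (cone_dual a b k).1 = 1.
Proof.
have [n] := ubnP (a + b); elim: n a b k => // n IH a b k hn cop.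
case: (eqVneq b 0%N) => [b0|b0].
  by move: cop; rewrite b0 /coprime gcdn0 => /eqP->; rewrite cone_dual0r /=; ring.
case: (eqVneq a 0%N) => [a0|a0].
  by move: cop; rewrite a0 /coprime gcd0n => /eqP->; rewrite cone_dual0l /=; ring.
case: (leqP b a) => h.
  rewrite cone_dual_left //.
  have /IH : (a - b + b < n)%N by lia.
  rewrite -{1}(subnK h) coprime_sym /coprime gcdnDr gcdnC -/(coprime _ _) in cop.
  move=> /(_ (k + 1) cop) /=; case: cone_dual => X Y /= E; rewrite -[RHS]E -subzn //; ring.
rewrite cone_dual_right ?(ltnW h) //.
have /IH : (a + (b - a) < n)%N by lia.
have cop' : coprime a (b - a).
  by move: cop; rewrite -{1}(subnK (ltnW h)) /coprime gcdnDr.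
move=> /(_ (k - 1) cop') /=; case: cone_dual => X Y /= E.
by rewrite -[RHS]E -subzn ?(ltnW h) //; ring.
Qed.


(** Vectors with determinant 1 or - 1 lie in a common subcone, (p, p + q) or (p + q, q), unless they
    are p and q themselves. A common subcone allows a simultaneous shear; for p and q the sum is
    [k + (3 - k)]. *)
Lemma cone_dual_pair (a b c d : nat) (k : int) :
    coprime a b -> coprime c d -> `|a%:Z * d%:Z - b%:Z * c%:Z| = 1 ->
  c%:Z * (cone_dual a b k).2 - d%:Z * (cone_dual a b k).1
  + (a%:Z * (cone_dual c d k).2 - b%:Z * (cone_dual c d k).1) = 3.
Proof.
have [n] := ubnP (a + b + c + d); elim: n a b c d k => // n IH a b c d k hn ab cd D.
have [/andP[ba dc]|] := boolP ((b <= a) && (d <= c))%N.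
  rewrite (@cone_dual_left a b) // (@cone_dual_left c d) //.
  (* The determinant excludes [b = d = 0], so the measure decreases. *)
  have /IH : (a - b + b + (c - d) + d < n)%N by nia.
  rewrite -{1}(subnK ba) coprime_sym /coprime gcdnDr gcdnC -/(coprime _ _) in ab.
  rewrite -{1}(subnK dc) coprime_sym /coprime gcdnDr gcdnC -/(coprime _ _) in cd.
  move=> /(_ (k + 1) ab cd) /=; case: cone_dual => X Y; case: cone_dual => Z T /= E.
  by rewrite -[RHS]E; rewrite -?subzn //; [ring | lia].
have [/andP[ba dc] _|] := boolP ((a <= b) && (c <= d))%N.
  rewrite (@cone_dual_right a b) // (@cone_dual_right c d) //.
  have /IH : (a + (b - a) + c + (d - c) < n)%N by nia.
  have ab' : coprime a (b - a) by move: ab; rewrite -{1}(subnK ba) /coprime gcdnDr.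
  have cd' : coprime c (d - c) by move: cd; rewrite -{1}(subnK dc) /coprime gcdnDr.
  move=> /(_ (k - 1) ab' cd') /=; case: cone_dual => X Y; case: cone_dual => Z T /= E.
  by rewrite -[RHS]E; rewrite -?subzn //; [ring | lia].
(* The vectors now lie strictly on opposite sides of the diagonal. *)
rewrite !negb_and -!ltnNge => h1 h2.
have [|] : (a = 1 /\ b = 0 /\ c = 0 /\ d = 1)%N \/ (a = 0 /\ b = 1 /\ c = 1 /\ d = 0)%N by nia.
  by move=> [-> [-> [-> ->]]]; rewrite cone_dual0l cone_dual0r /=; ring.
by move=> [-> [-> [-> ->]]]; rewrite cone_dual0l cone_dual0r /=; ring.
Qed.

(** * Half-plane signs and dual vectors in the whole plane *)

(* The sign of the linear form x + M y for large M. *)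
Definition side (v : 'cV[int]_2) : int :=
  if v 1 0 == 0 then sgz (v 0 0) else sgz (v 1 0).

Definition col2 (x y : int) : 'cV[int]_2 := \col_i (if i == 0 then x else y).


(* The upper half-plane is cut into the cones (e1, e2) and (e2, - e1).  The value
   k = - 3 makes both cones give e2 the same dual vector.  As side (- e1) = - 1,
   the relation for (e2, - e1) has right-hand side - 3 instead of 3; accordingly
   the second cone gives - e1 the dual vector of the first one plus 6 (- e1). *)
Definition dual_vec (v : 'cV[int]_2) : 'cV[int]_2 :=
  let a := (absz (v 0 0)) in let b := (absz (v 1 0)) in
  side v *: (if 0 <= v 0 0 * v 1 0
                  then let c := cone_dual a b 0 in col2 c.1 c.2
                  else let c := cone_dual b a (- 3) in col2 (- c.2) c.1).

Lemma dual_vec_nneg (s : int) (a b : nat) : `|s| = 1 -> (0 < a + b)%N ->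
  side (s *: col2 a%:Z b%:Z) = s /\
  dual_vec (s *: col2 a%:Z b%:Z) = let c := cone_dual a b 0 in s *: col2 c.1 c.2.
Proof.
move=> hs ab; set v := _ *: _.
have v0 : v 0 0 = s * a by rewrite !mxE.
have v1 : v 1 0 = s * b by rewrite !mxE.
have fs : side v = s by rewrite /side v0 v1; case: eqP; nia.
split=> //; rewrite /dual_vec fs v0 v1 ifT; last by nia.
have -> : `|(s * a)%R|%N = a by nia.
by have -> : `|(s * b)%R|%N = b by nia.
Qed.

Lemma dual_vec_npos (s : int) (a b : nat) : `|s| = 1 -> (0 < a)%N -> (0 < b)%N ->
  side (s *: col2 (- a%:Z) b%:Z) = s /\
  dual_vec (s *: col2 (- a%:Z) b%:Z) =
    let c := cone_dual b a (- 3) in s *: col2 (- c.2) c.1.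
Proof.
move=> hs a0 b0; set v := _ *: _.
have v0 : v 0 0 = - s * a by rewrite !mxE /=; ring.
have v1 : v 1 0 = s * b by rewrite !mxE.
have fs : side v = s by rewrite /side v0 v1; case: eqP; nia.
split=> //; rewrite /dual_vec fs v0 v1 ifF; last by nia.
have -> : `|(- s * a)%R|%N = a by nia.
by have -> : `|(s * b)%R|%N = b by nia.
Qed.

(** The axes belong to the first case, in accordance with the test [0 <= v 0 0 * v 1 0] in
    [dual_vec]. *)
Variant quadrant_spec (v : 'cV[int]_2) : Prop :=
| QuadrantNneg (s : int) (a b : nat) of `|s| = 1 & (0 < a + b)%N
    & v = s *: col2 a%:Z b%:Z
| QuadrantNpos (s : int) (a b : nat) of `|s| = 1 & (0 < a)%N & (0 < b)%N
    & v = s *: col2 (- a%:Z) b%:Z.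

Lemma quadrantP (v : 'cV[int]_2) : primitive v -> quadrant_spec v.
Proof.
rewrite /primitive => cop.
have nz : (0 < absz (v 0 0)%R + absz (v 1 0)%R)%N.
  rewrite lt0n; apply: contraL cop; rewrite addn_eq0 !absz_eq0.
  by case/andP=> /eqP-> /eqP->.
have ext x y (s : int) : v 0 0 = s * x -> v 1 0 = s * y -> v = s *: col2 x y.
  move=> h0 h1; apply/matrixP=> i j; rewrite !mxE (ord1 j).
  have : (i == 0) || (i == 1) by case: i => [[|[|]]].
  by case/orP=> /eqP-> /=; rewrite ?h0 ?h1.
have [xy|xy] := lerP 0 (v 0 0 * v 1 0).
  have [h|h] := boolP ((0 <= v 0 0) && (0 <= v 1 0)).
    by apply: (@QuadrantNneg _ 1 (absz (v 0 0)) (absz (v 1 0))) => //; apply: ext; lia.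
  by apply: (@QuadrantNneg _ (-1) (absz (v 0 0)) (absz (v 1 0))) => //; apply: ext; nia.
have [h|h] := lerP 0 (v 1 0).
  by apply: (@QuadrantNpos _ 1 (absz (v 0 0)) (absz (v 1 0))) => //; first [nia | apply: ext; nia].
by apply: (@QuadrantNpos _ (-1) (absz (v 0 0)) (absz (v 1 0))) => //; first [nia | apply: ext; nia].
Qed.

Lemma primitive_coprime (s : int) (x y : int) : `|s| = 1 ->
  primitive (s *: col2 x y) = coprime `|x| `|y|.
Proof.
by move=> hs; rewrite /primitive coprimezE !mxE /= !abszM (_ : `|s|%N = 1%N) ?mul1n //; lia.
Qed.

Lemma det2_dual (v : 'cV[int]_2) : primitive v -> det2 v (dual_vec v) = 1.
Proof.
move=> pv; have q := quadrantP pv; case: q pv => [s a b hs ab -> | s a b hs a0 b0 ->].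
  rewrite primitive_coprime // => cop; have [_ ->] := dual_vec_nneg hs ab.
  have := cone_dual_det 0 cop; case: cone_dual => X Y /= E.
  by rewrite det2E !mxE /= -{}E; have [->|->] : s = 1 \/ s = -1 by [lia| |]; ring.
rewrite primitive_coprime // abszN coprime_sym => cop.
have [_ ->] := dual_vec_npos hs a0 b0.
have := cone_dual_det (- 3) cop; case: cone_dual => X Y /= E.
by rewrite det2E !mxE /= -{}E; have [->|->] : s = 1 \/ s = -1 by [lia| |]; ring.
Qed.

(** Within one quadrant, up to signs, [cone_dual_pair] applies. Across two quadrants the determinant
    forces the vector of the closed quadrant onto an axis, hence up to sign into the closure of the
    other one. *)
Lemma det2_dual_pair (v w : 'cV[int]_2) :
    primitive v -> primitive w -> `|det2 v w| = 1 ->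
  det2 w (dual_vec v) + det2 v (dual_vec w) = 3 * (side v * side w).
Proof.
wlog : v w / 0 <= v 0 0 * v 1 0 \/ w 0 0 * w 1 0 < 0.
  move=> W; have [?|?] := lerP 0 (v 0 0 * v 1 0).
    by apply: W; left.
  have [?|?] := lerP 0 (w 0 0 * w 1 0); last by apply: W; right.
  move=> pv pw D; rewrite addrC [side v * _]mulrC; apply: W => //; first by left.
  by move: D; rewrite !det2E; nia.
move=> H pv pw.
have qv := quadrantP pv; have qw := quadrantP pw.
case: qv pv H => [s a b hs ab -> | s a b hs a0 b0 ->];
case: qw pw => [t c d ht cd -> | t c d ht c0 d0 ->] => pw pv H D;
rewrite !primitive_coprime ?abszN // in pv pw.
- have [-> ->] := dual_vec_nneg hs ab; have [-> ->] := dual_vec_nneg ht cd.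
  have D' : `|a%:Z * d%:Z - b%:Z * c%:Z| = 1 by move: D; rewrite det2E !mxE /=; nia.
  rewrite -(cone_dual_pair 0 pv pw D').
  case: cone_dual => X Y; case: cone_dual => Z T /=.
  by rewrite !det2E !mxE /=; ring.
- have [-> ->] := dual_vec_nneg hs ab; have [-> ->] := dual_vec_npos ht c0 d0.
  have D' : `|a%:Z * d%:Z + b%:Z * c%:Z| = 1 by move: D; rewrite det2E !mxE /=; nia.
  rewrite coprime_sym in pw.
  have [[a1 b0]|[a0 b1]] : (a = 1 /\ b = 0 \/ a = 0 /\ b = 1)%N by nia.
    have d1 : d = 1%N by nia.
    (* Up to sign, [v] is - e1, with coordinates (0, 1) in the cone (e2, - e1); the relation of that
       cone yields the first dual coordinate of the other vector. *)
    have ca : coprime 0 1 by [].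
    have D0 : `|d%:Z * 1%:Z - c%:Z * 0%:Z| = 1 by lia.
    have := cone_dual_pair (- 3) pw ca D0; rewrite a1 b0 d1 cone_dual0r cone_dual0l /=.
    case: cone_dual => X Y /= E; rewrite !det2E !mxE /=.
    rewrite (_ : X = c%:Z + 3); [ring | lia].
  have c1 : c = 1%N by nia.
  have ca : coprime 1 0 by [].
  have D0 : `|d%:Z * 0%:Z - c%:Z * 1%:Z| = 1 by lia.
  have := cone_dual_pair (- 3) pw ca D0; rewrite a0 b1 c1 cone_dual0r cone_dual0l /=.
  case: cone_dual => X Y /= E; rewrite !det2E !mxE /=.
  rewrite (_ : Y = 6 - d%:Z); [ring | lia].
- by exfalso; move: H; rewrite !mxE /=; nia.
- have [-> ->] := dual_vec_npos hs a0 b0; have [-> ->] := dual_vec_npos ht c0 d0.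
  have D' : `|b%:Z * c%:Z - a%:Z * d%:Z| = 1 by move: D; rewrite det2E !mxE /=; nia.
  rewrite coprime_sym in pv; rewrite coprime_sym in pw.
  have := cone_dual_pair (- 3) pv pw D'.
  case: cone_dual => X Y; case: cone_dual => Z T /= <-.
  by rewrite !det2E !mxE /=; ring.
Qed.

(** * Subdivision of a cone along its Hirzebruch-Jung expansion *)

Lemma det2DZl (a b : int) (v w z : 'cV[int]_2) :
  det2 (a *: v + b *: w) z = a * det2 v z + b * det2 w z.
Proof. by rewrite !det2E !mxE; ring. Qed.

Lemma primitive_det1 (v w : 'cV[int]_2) : `|det2 v w| = 1 -> primitive w.
Proof.
rewrite det2E => D; apply/coprimezP.
have [E|E] : v 0 0 * w 1 0 - v 1 0 * w 0 0 = 1 \/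
             v 0 0 * w 1 0 - v 1 0 * w 0 0 = -1 by lia.
  by exists (- v 1 0, v 0 0) => /=; rewrite -[RHS]E; ring.
by exists (v 1 0, - v 0 0) => /=; rewrite -[RHS]opprK -E; ring.
Qed.

Lemma side_eq (v : 'cV[int]_2) (t : int) : `|t| = 1 ->
  (side v == t) = (0 < t * v 1 0) || (v 1 0 == 0) && (0 < t * v 0 0).
Proof.
move=> ht; have [->|->] : t = 1 \/ t = -1 by lia.
  by rewrite /side; case: (eqVneq (v 1 0) 0) => h /=; apply/eqP/idP; lia.
by rewrite /side; case: (eqVneq (v 1 0) 0) => h /=; apply/eqP/idP; lia.
Qed.

Lemma side_norm (v : 'cV[int]_2) : primitive v -> `|side v| = 1.
Proof.
move=> pv; have [s a b hs ab ->|s a b hs a0 b0 ->] := quadrantP pv.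
  by have [-> _] := dual_vec_nneg hs ab.
by have [-> _] := dual_vec_npos hs a0 b0.
Qed.

(** If [v] and [w] have the same side, so does their positive combination [u]; otherwise both
    members of the equation vanish. Hence [1 - side v * side w] is additive when [u] subdivides the
    cone. *)
Lemma side_cone (a b c : int) (u v w : 'cV[int]_2) :
    0 < a -> 0 < b -> 0 < c -> a *: u = b *: v + c *: w ->
    primitive u -> primitive v -> primitive w ->
  side u * (side v + side w) = 1 + side v * side w.
Proof.
move=> a0 b0 c0 E pu pv pw.
have E0 := congr1 (fun z : 'cV_2 => z 0 0) E.
have E1 := congr1 (fun z : 'cV_2 => z 1 0) E; rewrite !mxE in E0 E1.
have su := side_norm pu; have sv := side_norm pv.
have sw := side_norm pw.
have [h|h] := eqVneq (side v) (side w); last by nia.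
suff -> : side u = side v by rewrite -h; nia.
apply/eqP; rewrite side_eq //.
have /eqP := esym h; rewrite side_eq // => hw.
have := eqxx (side v); rewrite side_eq // => hv.
have pos (x y z : int) : 0 <= y -> 0 <= z -> 0 < y + z ->
    a * x = b * y + c * z -> 0 < x by nia.
move: (side v) sv hv hw => t ht.
have F0 : a * (t * u 0 0) = b * (t * v 0 0) + c * (t * w 0 0).
  by rewrite mulrCA E0; ring.
have F1 : a * (t * u 1 0) = b * (t * v 1 0) + c * (t * w 1 0).
  by rewrite mulrCA E1; ring.
move=> /orP[hv|/andP[/eqP hv hv']] /orP[hw|/andP[/eqP hw hw']]; apply/orP.
- by left; apply: (pos _ _ _ _ _ _ F1); lia.
- by left; apply: (pos _ _ _ _ _ _ F1); rewrite ?hw ?mulr0; lia.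
- by left; apply: (pos _ _ _ _ _ _ F1); rewrite ?hv ?mulr0; lia.
right; apply/andP; split; last by apply: (pos _ _ _ _ _ _ F0); lia.
by move: E1; rewrite hv hw !mulr0 => /eqP; rewrite mulf_eq0 (gt_eqF a0).
Qed.

Lemma hj_value_from_gt1 (s : seq int) (m : int) :
  (forall k, k \in m :: s -> 2 <= k) -> 1 < hj_value_from m s.
Proof.
elim: s m => [|n s IH] m h /=.
  by rewrite ltr1z; apply: lt_le_trans (h m _); rewrite ?mem_head.
have /IH q1 : forall k, k \in n :: s -> 2 <= k.
  by move=> k ks; apply: h; rewrite inE ks orbT.
have q0 : 0 < hj_value_from n s by apply: lt_trans q1.
have m2 : 2 <= m%:~R :> rat by rewrite (ler_int _ 2); apply: h; rewrite mem_head.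
have : (hj_value_from n s)^-1 < 1 by rewrite invf_lt1.
lra.
Qed.

(** One step of division by excess: [x' = n1 * x - m], and the tail of the expansion has value
    [x / x']. As that value exceeds 1, [x'] lies strictly between 0 and [x], unless the tail is
    empty. *)
Lemma hj_expansion_cons (m x : nat) (n1 : int) (n : seq int) :
    (0 < m)%N -> coprime m x -> hj_expansion (m%:R / x%:R) (n1 :: n) ->
  exists x' : nat,
  [/\ n1 * x = m%:Z + x'%:Z, (0 < x)%N, (x' < x)%N, (2 <= x)%N -> hj_expansion (x%:R / x'%:R) n
    & x = 1%N -> n = [::]].
Proof.
move=> m0 cop [hk hv].
have x0 : (0 < x)%N.
  (* Since [0^-1 = 0], the choice [x = 0] would give the expansion the value 0. *)
  rewrite lt0n; apply: contraTneq (hj_value_from_gt1 hk) => xE.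
  by rewrite hv xE invr0 mulr0.
have xQ : x%:R != 0 :> rat by rewrite pnatr_eq0 -lt0n.
case: n hk hv => [|n2 n] hk /= hv.
  have {}hv : n1 * x = m.
    apply/eqP; rewrite -(eqr_int rat) intrM hv; apply/eqP. 
    by rewrite -!pmulrn divfK.
  exists 0%N; split=> //; first by rewrite addr0.
  (* Divisibility and coprimality give [x = 1], so the clause for [2 <= x] is vacuous. *)
  have : (x %| m)%N by apply/dvdnP; exists (absz n1); nia.
  by move=> /gcdn_idPr; move: cop; rewrite /coprime => /eqP-> <-.
have q1 : 1 < hj_value_from n2 n.
  by apply: hj_value_from_gt1 => k hk'; apply: hk; rewrite inE hk' orbT.
set q := hj_value_from n2 n in hv q1 *.
have q0 : q != 0 by rewrite gt_eqF // (lt_trans _ q1).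
have E : (n1 * x%:Z - m%:Z)%:~R = x%:R / q :> rat.
  rewrite intrB intrM -!pmulrn.
  have : n1%:~R = m%:R / x%:R + q^-1 :> rat by rewrite -hv; ring.
  by move=> ->; field; rewrite xQ q0.
have xx : n1 * x%:Z - m%:Z < x.
  rewrite -(ltr_int rat) E -pmulrn ltr_pdivrMr ?(lt_trans _ q1) //.
  by rewrite ltr_pMr // ltr0n.
have xx0 : 0 < n1 * x%:Z - m%:Z.
  by rewrite -(ltr_int rat) E divr_gt0 ?ltr0n // (lt_trans _ q1).
exists (absz (n1 * x%:Z - m%:Z)%R); split; try lia.
move=> _; split; first by move=> k ks; apply: hk; rewrite inE ks orbT.
have -> : (absz (n1 * x%:Z - m%:Z)%R)%:R = x%:R / q :> rat by rewrite -E natr_absz gtr0_norm.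
by rewrite -/q; field; rewrite xQ q0.
Qed.

Lemma det2Zl (a : int) (v z : 'cV[int]_2) : det2 (a *: v) z = a * det2 v z.
Proof. by rewrite !det2E !mxE; ring. Qed.

Lemma det2Zr (a : int) (v z : 'cV[int]_2) : det2 v (a *: z) = a * det2 v z.
Proof. by rewrite !det2E !mxE; ring. Qed.

Lemma det2DZr (a b : int) (v w z : 'cV[int]_2) :
  det2 z (a *: v + b *: w) = a * det2 z v + b * det2 z w.
Proof. by rewrite !det2E !mxE; ring. Qed.

Lemma det2vv (v : 'cV[int]_2) : det2 v v = 0.
Proof. by rewrite det2E; ring. Qed.

(** This is twelve times the contribution of one edge. The integral vectors [u] and [z] carry the
    information of the matrices defining [x] and [y]. The induction follows the expansion, with [w]
    fixed and [v] replaced by [u]. *)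
Lemma edge_identity (K : numFieldType) (n : seq int) (v w u z : 'cV[int]_2)
    (s : int) (m x y : nat) :
    `|s| = 1 -> primitive v -> primitive w -> det2 v w = s * m%:Z ->
    (0 < m)%N -> (x < m)%N -> (y < m)%N ->
    m%:Z *: u = x%:Z *: v + 1 *: w -> m%:Z *: z = y%:Z *: w + 1 *: v ->
    ((2 <= m)%N -> hj_expansion (m%:R / x%:R) n) -> (m = 1%N -> n = [::]) ->
  (3 * (size n).+1%:R - \sum_(k <- n) k%:~R) * s%:~R
    - (x%:R + y%:R) / (s%:~R * m%:R)
    - (det2 w (dual_vec v) + det2 v (dual_vec w))%:~R / (s%:~R * m%:R)
  = 3 * s%:~R * (1 - (side v * side w)%:~R) :> K.
Proof.
elim: n v u m x y => [|n1 n IH] v u m x y hs pv pw hD m0 xm ym hu hz hn hn1.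
  (* [hj_expansion] is false on the empty list, which excludes [2 <= m]. *)
  have m1 : m = 1%N.
    by apply/eqP; rewrite eqn_leq m0 andbT leqNgt; apply/negP => /hn.
  have [x0 y0] : x = 0%N /\ y = 0%N by lia.
  rewrite det2_dual_pair //; last by rewrite hD m1; lia.
  rewrite m1 x0 y0 big_nil /= !intrM.
  by have [->|->] : s = 1 \/ s = -1 by [lia| |]; field.
(* The cone of (v, w) is the union of the unimodular cone of (v, u) and of the
   cone of (u, w), whose data are x, x' = n1 x - m and y' = (x y - 1) / m in place
   of m, x and y, and whose continued fraction is the tail of that of (v, w). *)
have m2 : (2 <= m)%N by case: m m0 hn1 {xm ym hu hz hn hD} => [|[|m]] // _ /(_ erefl).
have xy : exists y' : nat, (x * y = m * y' + 1)%N /\ (y' < x)%N.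
  (* Eliminating [v] between [hu] and [hz] and pairing with the dual vector of [w] gives [x * y = 1]
     modulo [m]. *)
  have : (x%:Z * y%:Z - 1) *: w + m%:Z *: u = (x%:Z * m%:Z) *: z.
    by rewrite -scalerA hz hu; apply/matrixP=> i j; rewrite !mxE; ring.
  move=> /(congr1 (fun t => det2 t (dual_vec w))).
  rewrite det2DZl det2_dual // det2Zl; set g := det2 u _; set h := det2 z _ => E.
  have {}E : x%:Z * y%:Z - 1 = m%:Z * (x%:Z * h - g).
    by rewrite mulrBr [m%:Z * _]mulrCA mulrA -E; ring.
  have q0 : 0 <= x%:Z * h - g by nia.
  exists (absz (x%:Z * h - g)%R); split; nia.
case: xy => y' [xy y'x].
have cop : coprime m x.
  rewrite /coprime -dvdn1 -(@dvdn_addr (m * y')%N) ?dvdn_mulr ?dvdn_gcdl //.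
  by rewrite -xy dvdn_mulr // dvdn_gcdr.
have [x' [n1E x0 x'x hexp hnil]] := hj_expansion_cons m0 cop (hn m2).
have mI (a b : int) : m%:Z * a = m%:Z * b -> a = b by nia.
have dvu : det2 v u = s.
  by apply: mI; rewrite -det2Zr hu det2DZr det2vv hD; ring.
have duw : det2 u w = s * x%:Z.
  by apply: mI; rewrite -det2Zl hu det2DZl det2vv hD; ring.
have pu : primitive u by apply: (@primitive_det1 v); rewrite dvu.
(* Consecutive vectors v, u, u' of the subdivision satisfy v + u' = n1 u, which gives the next
   one. *)
have hu' : x%:Z *: (n1 *: u - v) = x'%:Z *: u + 1 *: w.
  have -> : 1 *: w = m%:Z *: u - x%:Z *: v by rewrite hu addrC addKr.
  rewrite scalerBr scalerA mulrC n1E addrA -scalerDl; congr (_ *: _ - _); ring.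
have hz' : x%:Z *: z = y'%:Z *: w + 1 *: u.
  apply/matrixP => i j; have := congr1 (fun t : 'cV_2 => t i j) hz.
  have := congr1 (fun t : 'cV_2 => t i j) hu; rewrite !mxE => hui hzi.
  have xyZ : x%:Z * y%:Z = m%:Z * y'%:Z + 1 by lia.
  apply: mI; rewrite mulrCA hzi mulrDr mulrA xyZ mulrDr [m%:Z * (1 * _)]mulrCA hui.
  ring.
have := IH u (n1 *: u - v) x x' y' hs pu pw duw x0 x'x y'x hu' hz' hexp hnil.
have pvu : det2 u (dual_vec v) + det2 v (dual_vec u) = 3 * (side v * side u).
  by apply: det2_dual_pair => //; rewrite dvu.
have cone : side u * (side v + side w) = 1 + side v * side w.
  by apply: (side_cone _ _ _ hu) => //; lia.
have e1 : m%:Z * det2 u (dual_vec v) = x%:Z + det2 w (dual_vec v).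
  by rewrite -det2Zl hu det2DZl det2_dual //; ring.
have e2 : m%:Z * det2 u (dual_vec w) = x%:Z * det2 v (dual_vec w) + 1.
  by rewrite -det2Zl hu det2DZl det2_dual //; ring.
have e3 : m%:Z = x%:Z * det2 v (dual_vec u) + det2 w (dual_vec u).
  by rewrite -[LHS]mulr1 -(det2_dual pu) -det2Zl hu det2DZl; ring.
move: pvu cone e1 e2 e3 xy n1E.
rewrite big_cons /=.
move: (side v) (side u) (side w) => sv su sw.
move: (det2 u (dual_vec v)) (det2 v (dual_vec u)) (det2 w (dual_vec v)) => p1 q1 p.
move: (det2 u (dual_vec w)) (det2 v (dual_vec w)) (det2 w (dual_vec u)) => q2 q p2.
move=> pvu cone e1 e2 e3 xy n1E {IH}.
have mK : m%:R != 0 :> K by rewrite pnatr_eq0 -lt0n.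
have xK : x%:R != 0 :> K by rewrite pnatr_eq0 -lt0n.
have toK (a b : int) : a = b -> a%:~R = b%:~R :> K by move=> ->.
move: {xy}(toK (x * y)%N%:Z (m * y' + 1)%N%:Z (congr1 Posz xy)).
move: (toK _ _ pvu) (toK _ _ cone) (toK _ _ e1) (toK _ _ e2) (toK _ _ e3) (toK _ _ n1E).
rewrite -!pmulrn !natrD !natrM !rmorphD /= !rmorphM /= !rmorphD /= -!pmulrn.
move=> h1 h2 h3 h4 h5 h6 h7 h8.
(* The right-hand side splits over the two subcones; [h8] (induction) treats (u, w) and [h1] the
   unimodular cone (v, u). *)
have -> : 3 * s%:~R * (1 - sv%:~R * sw%:~R) =
    3 * s%:~R * (1 - su%:~R * sw%:~R) + s%:~R * (3 - 3 * (sv%:~R * su%:~R)) :> K.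
  rewrite -[sv%:~R * sw%:~R](addKr 1) -h2; ring.
rewrite -h8 -[3 * (_ * su%:~R)]/((1 + (1 + 1)) * _) -h1.
have -> : p%:~R = m%:R * p1%:~R - x%:R :> K by rewrite h3 addrC addKr.
have -> : p2%:~R = m%:R - x%:R * q1%:~R :> K by rewrite {1}h5 addrC addKr.
have -> : q%:~R = (m%:R * q2%:~R - 1) / x%:R :> K by rewrite h4 addrK mulrC mulKf.
have -> : n1%:~R = (m%:R + x'%:R) / x%:R :> K by rewrite -h6 mulfK.
have -> : y%:R = (m%:R * y'%:R + 1) / x%:R :> K by rewrite -h7 mulrC mulKf.
rewrite -[(size n).+2]addn1 natrD.
by have [->|->] : s = 1 \/ s = -1 by [lia| |]; field; rewrite mK xK.
Qed.

(** * The angle form along a segment *)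

Section Analysis.
Context (R : realType).

(** The first hypothesis says that [z] is the cotangent of [atan x + atan y]; positivity of [x + y]
    puts this angle in (0, pi), so its complement is in the range of [atan]. *)
Lemma atan_add3 (x y z : R) :
  x * y + y * z + z * x = 1 -> 0 < x + y -> atan x + atan y + atan z = pi / 2.
Proof.
move=> h xy0.
have cx : 0 < cos (atan x) by apply: cos_gt0_pihalf; rewrite atan_gtNpi2 atan_ltpi2.
have cy : 0 < cos (atan y) by apply: cos_gt0_pihalf; rewrite atan_gtNpi2 atan_ltpi2.
have tx := atanK x; have ty := atanK y; rewrite /tan in tx ty.
have sx : sin (atan x) = x * cos (atan x) by rewrite -{2}tx divfK // gt_eqF.
have sy : sin (atan y) = y * cos (atan y) by rewrite -{2}ty divfK // gt_eqF.
have zE : z = (1 - x * y) / (x + y).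
  by apply: (mulIf (lt0r_neq0 xy0)); rewrite divfK ?lt0r_neq0 // -h; ring.
have [x1 x2] := (atan_gtNpi2 x, atan_ltpi2 x).
have [y1 y2] := (atan_gtNpi2 y, atan_ltpi2 y).
have s0 : 0 < atan x + atan y.
  by rewrite -ltrBlDr sub0r -atanN; apply: lt_atan; rewrite -subr_gt0 opprK.
suff -> : atan z = pi / 2 - (atan x + atan y) by rewrite addrC subrK.
have I : pi / 2 - (atan x + atan y) \in `](- (pi / 2)), (pi / 2)[.
  by rewrite in_itv /=; apply/andP; split; lra.
rewrite -(tanK I) zE; congr atan.
rewrite /tan cosB sinB cos_pihalf sin_pihalf !mul0r !mul1r add0r subr0.
have -> : cos (atan x + atan y) = cos (atan x) * cos (atan y) * (1 - x * y).
  by rewrite cosD sx sy; ring.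
have -> : sin (atan x + atan y) = cos (atan x) * cos (atan y) * (x + y).
  by rewrite sinD sx sy; ring.
by rewrite -mulf_div divff ?mul1r // mulf_neq0 // lt0r_neq0.
Qed.

Lemma integral_derive_atan (c e : R) :
  \int[@lebesgue_measure R]_(t in `[0, 1]) (e * (1 + (c + e * t) ^+ 2)^-1)
  = atan (c + e) - atan c.
Proof.
have dl (t : R) : is_derive t 1 (fun t : R => c + e * t) e.
  by apply: is_derive_eq; rewrite add0r mul1r /GRing.scale /= mulr1.
pose F (t : R) := atan (c + e * t).
have dF (t : R) : is_derive t 1 F (e * (1 + (c + e * t) ^+ 2)^-1).
  by rewrite [e * _]mulrC; exact: (is_derive1_comp (is_derive1_atan _) (dl t)).
have cl (t : R) : {for t, continuous (fun t : R => c + e * t)}.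
  by apply: differentiable_continuous; apply/derivable1_diffP; case: (dl t).
have cF (t : R) : {for t, continuous F}.
  by apply: differentiable_continuous; apply/derivable1_diffP; case: (dF t).
rewrite /Rintegral (@continuous_FTC2 _ _ F) //.
- by rewrite /F mulr1 mulr0 addr0.
- apply: continuous_in_subspaceT => t _.
  apply: cvgM; first exact: cvg_cst.
  apply: cvgV; first by rewrite gt_eqF // ltr_pwDl // sqr_ge0.
  by apply: cvgD; [exact: cvg_cst | rewrite expr2; apply: cvgM; exact: cl].
- split.
  + by move=> t _; case: (dF t).
  + by apply: cvg_at_right_filter; exact: cF.
  + by apply: cvg_at_left_filter; exact: cF.
- by move=> t _; rewrite derive1E; exact: derive_val.
Qed.

Lemma atan_add3_sg (x y z : R) :
    x * y + y * z + z * x = 1 -> x + y != 0 ->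
  atan x + atan y + atan z = Num.sg (x + y) * (pi / 2).
Proof.
move=> h /lt_total/orP[xy0|xy0]; last by rewrite gtr0_sg // mul1r atan_add3.
rewrite ltr0_sg // mulN1r -(@atan_add3 (- x) (- y) (- z)).
- by rewrite !atanN; ring.
- by rewrite -h; ring.
- by rewrite -opprD oppr_gt0.
Qed.

Local Notation cross A B := (A 0 0 * B 1 0 - A 1 0 * B 0 0).
Local Notation dot A B := (A 0 0 * B 0 0 + A 1 0 * B 1 0).

(** By Lagrange's identity, squared dot plus squared cross product of position and velocity is the
    product of the squared norms. *)
Lemma angular_speed (x y u v : R) : x * v - y * u != 0 ->
  - y / (x ^+ 2 + y ^+ 2) * u + x / (x ^+ 2 + y ^+ 2) * v =
  (u * u + v * v) / (x * v - y * u)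
  * (1 + ((x * u + y * v) / (x * v - y * u)) ^+ 2)^-1.
Proof.
move=> r0; have nz (a b : R) : a ^+ 2 + b ^+ 2 = 0 -> a = 0 /\ b = 0.
  by move/eqP; rewrite paddr_eq0 ?sqr_ge0 // !sqrf_eq0 => /andP[/eqP-> /eqP->].
have xy0 : x ^+ 2 + y ^+ 2 != 0.
  by apply: contra_neq r0 => /nz[-> ->]; rewrite !mul0r subr0.
have uv0 : u ^+ 2 + v ^+ 2 != 0.
  by apply: contra_neq r0 => /nz[-> ->]; rewrite !mulr0 subr0.
have -> : 1 + ((x * u + y * v) / (x * v - y * u)) ^+ 2 =
    (x ^+ 2 + y ^+ 2) * (u ^+ 2 + v ^+ 2) / (x * v - y * u) ^+ 2 by field.
by field; rewrite xy0 uv0 r0.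
Qed.

(** Along the segment the cross product of position and velocity is constant and their dot product
    is affine in [t]. *)
Lemma segment_integral_atan (A B : 'cV[R]_2) : cross A B != 0 ->
  segment_integral (fun x y => - y / (x ^+ 2 + y ^+ 2))
                   (fun x y => x / (x ^+ 2 + y ^+ 2)) A B =
  atan (dot B (B - A) / cross A B) - atan (dot A (B - A) / cross A B).
Proof.
move=> r0; pose c := dot A (B - A) / cross A B.
pose e := dot (B - A) (B - A) / cross A B.
have -> : dot B (B - A) / cross A B = c + e.
  by rewrite /c /e -mulrDl; congr (_ / _); rewrite !mxE; ring.
rewrite -integral_derive_atan; apply: eq_Rintegral => t _.
have gE i : ((1 - t) *: A + t *: B) i 0 = A i 0 + t * (B - A) i 0.
  by rewrite !mxE; ring.
have rE : cross A B = cross ((1 - t) *: A + t *: B) (B - A).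
  by rewrite !mxE; ring.
have cE : c + e * t = dot ((1 - t) *: A + t *: B) (B - A) / cross A B.
  by rewrite /c /e mulrAC -mulrDl !gE; congr (_ / _); ring.
by rewrite cE /e rE; apply: angular_speed; rewrite -rE.
Qed.

(** With an auxiliary direction [b], each [atan] term depends on one endpoint only and cancels along
    a closed sequence; only signs remain. *)
Lemma segment_integral_angle (A B b : 'cV[R]_2) :
    cross A B != 0 -> cross b A != 0 -> cross b B != 0 ->
  segment_integral (fun x y => - y / (x ^+ 2 + y ^+ 2))
                   (fun x y => x / (x ^+ 2 + y ^+ 2)) A B =
  atan (dot b A / cross b A) - atan (dot b B / cross b B)
  + pi / 2 * (Num.sg (cross A B)
              * (1 - Num.sg (cross b A) * Num.sg (cross b B))).
Proof.
move=> r0 p0 q0.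
rewrite segment_integral_atan //.
(* Both sides are compared with atan C, the complement of the angle of A and B. *)
set C := dot A B / cross A B.
have pos (V : 'cV[R]_2) : V 0 0 != 0 \/ V 1 0 != 0 -> 0 < dot V V.
  rewrite -!expr2 => V0; rewrite lt0r paddr_eq0 ?sqr_ge0 // !sqrf_eq0.
  rewrite addr_ge0 ?sqr_ge0 // andbT negb_and; exact/orP.
have nz (V W : 'cV[R]_2) : cross V W != 0 -> V 0 0 != 0 \/ V 1 0 != 0.
  move=> h; apply/orP; rewrite -negb_and; apply: contra h => /andP[/eqP-> /eqP->].
  by rewrite !mul0r subr0.
have b0 := pos _ (nz _ _ p0).
have u0 : 0 < dot (B - A) (B - A).
  have : cross A B = cross A (B - A) by rewrite !mxE; ring.
  move=> E; apply: pos; apply: (nz _ (- A)); apply: contra_neq r0 => h.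
  by rewrite E -[RHS]h !mxE; ring.
have E1 : dot B (B - A) / cross A B + - (dot A (B - A) / cross A B) =
          dot (B - A) (B - A) / cross A B.
  by rewrite !mxE; field.
have E2 : dot b A / cross b A + - (dot b B / cross b B) =
          dot b b * cross A B / (cross b A * cross b B).
  by field; rewrite p0 q0.
have s1 : Num.sg (dot (B - A) (B - A) / cross A B) = Num.sg (cross A B).
  by rewrite sgrM sgrV gtr0_sg // mul1r.
have s2 : Num.sg (dot b b * cross A B / (cross b A * cross b B)) =
    Num.sg (cross A B) * (Num.sg (cross b A) * Num.sg (cross b B)).
  by rewrite !sgrM sgrV !sgrM gtr0_sg // mul1r.
have := @atan_add3_sg (dot B (B - A) / cross A B) (- (dot A (B - A) / cross A B)) C.
rewrite E1 s1 => /(_ _ _)/wrap[].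
  by rewrite /C !mxE; field.
  by rewrite mulf_neq0 ?invr_eq0 // gt_eqF.
have := @atan_add3_sg (dot b A / cross b A) (- (dot b B / cross b B)) C.
rewrite E2 s2 => /(_ _ _)/wrap[].
  by rewrite /C; field; rewrite r0 p0 q0.
  by rewrite !mulf_neq0 ?invr_eq0 ?mulf_neq0 // gt_eqF.
rewrite !atanN => /(canRL (addrK _))-> /(canRL (addrK _))->; ring.
Qed.
End Analysis.

(** * The rotation number as a sum of half-plane signs *)

Lemma side_sgz (v : 'cV[int]_2) (M : int) : `|v 0 0| < M ->
  sgz (M * v 1 0 + v 0 0) = side v.
Proof.
move=> h; rewrite /side; case: eqP => [->|v1]; first by rewrite mulr0 add0r.
have [p|p] := ltrP 0 (v 1 0); first by rewrite !gtr0_sgz //; nia.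
by rewrite !ltr0_sgz //; nia.
Qed.

Lemma rotation_number_side (R : realType) (d : nat) (v : 'I_d -> 'cV[int]_2) :
    (forall i, primitive (v i)) -> (forall i, eps v i != 0) ->
  rotation_number R v =
  4^-1 * \sum_(i < d) (sgz (eps v i) * (1 - side (v i) * side (v (ordS i))))%:~R.
Proof.
move=> pv e0; rewrite /rotation_number.
have [M hM] : exists M : int, forall i, `|v i 0 0| < M.
  exists (1 + \sum_(i < d) `|v i 0 0|) => i.
  by rewrite (bigD1 i) //= addrCA ltrDl ltr_pwDl // sumr_ge0.
(* The cross product of (M, - 1) with a vector is the linear form whose sign is [side]; one [M]
   serves all the [v i]. *)
pose b : 'cV[R]_2 := \col_i (if i == 0 then M%:~R else -1).
have bE i : b 0 0 * (map_mx intr (v i) : 'cV[R]_2) 1 0 - b 1 0 * (map_mx intr (v i) : 'cV[R]_2) 0 0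
   = (M * v i 1 0 + v i 0 0)%:~R.
  by rewrite !mxE /= intrD intrM; ring.
have sb i : Num.sg ((M * v i 1 0 + v i 0 0)%:~R : R) = (side (v i))%:~R.
  by rewrite sgrEz sgz_int side_sgz.
have b0 i : M * v i 1 0 + v i 0 0 != 0.
  by rewrite -(intr_eq0 R) -sgr_eq0 sb intr_eq0 -normr_eq0 side_norm ?oner_eq0 //.
have cE i : (map_mx intr (v i) : 'cV[R]_2) 0 0 * (map_mx intr (v (ordS i)) : 'cV[R]_2) 1 0 -
  (map_mx intr (v i) : 'cV[R]_2) 1 0 * (map_mx intr (v (ordS i)) : 'cV[R]_2) 0 0 = (eps v i)%:~R.
  by rewrite !mxE /eps det2E intrB !intrM.
pose alpha (w : 'cV[int]_2) : R :=
  atan ((b 0 0 * (map_mx intr w : 'cV[R]_2) 0 0 + b 1 0 * (map_mx intr w : 'cV[R]_2) 1 0)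
   / (M * w 1 0 + w 0 0)%:~R).
transitivity ((2 * pi)^-1 * \sum_(i < d) (alpha (v i) - alpha (v (ordS i)) +
   pi / 2 * (sgz (eps v i) * (1 - side (v i) * side (v (ordS i))))%:~R)).
  congr (_ * _); apply: eq_bigr => i _.
  rewrite (@segment_integral_angle R _ _ b) ?bE ?cE ?intr_eq0 //.
  by rewrite !sb sgrEz sgz_int; congr (_ + _ * _); rewrite intrM intrB intrM.
rewrite big_split /= sumrB.
rewrite [X in _ - X](_ : _ = \sum_(i < d) alpha (v i)); last first.
  by rewrite [RHS](reindex_inj (@ordS_inj d)).
rewrite subrr add0r -mulr_sumr mulrA; congr (_ * _).
by move: (pi : R) (pi_gt0 R) => p p0; field; exact: lt0r_neq0.
Qed.

(** * From the given data to sums over edges *)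

(** The witness is the second column of the normalized matrix, whose first column is [v]. *)
Lemma normalized_dvd (v w : 'cV[int]_2) (x m : nat) : (0 < m)%N ->
  unimodular (normalized v w x m) ->
  exists u : 'cV[int]_2, m%:Z *: u = x%:Z *: v + 1 *: w.
Proof.
move=> m0 /andP[/mxOverP Nint _].
have mQ : m%:R != 0 :> rat by rewrite pnatr_eq0 -lt0n.
set N := normalized v w x m in Nint.
have shearE : [/\ shear_mx x m 0 0 = 1, shear_mx x m 0 1 = - x%:R,
                  shear_mx x m 1 0 = 0 & shear_mx x m 1 1 = m%:R].
  pose a : 'M[rat]_1 := 1%:M; pose b : 'M[rat]_1 := (- x%:R)%:M.
  pose c : 'M[rat]_1 := 0; pose d : 'M[rat]_1 := m%:R%:M.
  split.
  - transitivity (a 0 0); last by rewrite mxE.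
    by rewrite -(block_mxEul a b c d); congr fun_of_matrix; apply/val_inj.
  - transitivity (b 0 0); last by rewrite mxE.
    by rewrite -(block_mxEur a b c d); congr fun_of_matrix; apply/val_inj.
  - transitivity (c 0 0); last by rewrite mxE.
    by rewrite -(block_mxEdl a b c d); congr fun_of_matrix; apply/val_inj.
  - transitivity (d 0 0); last by rewrite mxE.
    by rewrite -(block_mxEdr a b c d); congr fun_of_matrix; apply/val_inj.
have [s00 s01 s10 s11] := shearE.
have shearU : shear_mx x m \in unitmx.
  by rewrite unitmxE det_mx2 s00 s10 s11 mul1r mul0r subr0 unitfE.
have NE : N *m shear_mx x m = map_mx intr (columns v w) by rewrite mulmxKV.
have l0 : lift 0 0 = 1 :> 'I_2 by exact/val_inj.
have N0 i : N i 0 = (v i 0)%:~R.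
  have := congr1 (fun A : 'M[rat]_2 => A i 0) NE.
  rewrite [LHS]mxE [RHS]mxE !big_ord_recl big_ord0 columnsE0 l0 s00 s10 => <-; ring.
have N1 i : m%:R * N i 1 - x%:R * N i 0 = (w i 0)%:~R.
  have := congr1 (fun A : 'M[rat]_2 => A i 1) NE.
  rewrite [LHS]mxE [RHS]mxE !big_ord_recl big_ord0 columnsE1 l0 s01 s11 => <-; ring.
have uP i : {z : int | N i 1 = z%:~R}.
  by exists (Num.floor (N i 1)); rewrite floorK.
exists (\col_i sval (uP i)); apply/matrixP => i j; rewrite (ord1 j) !mxE.
rewrite ![in RHS]mxE; apply/eqP; rewrite -(eqr_int rat) intrD !intrM -N0 -(svalP (uP i)) -N1.
by apply/eqP; rewrite -!pmulrn; ring.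
Qed.

Lemma a_coef_dual (K : fieldType) (d : nat) (v : 'I_d -> 'cV[int]_2) (i : 'I_d) :
    primitive (v i) -> (eps v i)%:~R != 0 :> K -> (eps v (ord_pred i))%:~R != 0 :> K ->
  a_coef v K i = - ((det2 (v (ordS i)) (dual_vec (v i)))%:~R / (eps v i)%:~R
    + (det2 (v (ord_pred i)) (dual_vec (v i)))%:~R / (eps v (ord_pred i))%:~R).
Proof.
move=> pv e0 e1.
have E : det2 (v (ordS i)) (v (ord_pred i)) =
   - (det2 (v (ordS i)) (dual_vec (v i)) * eps v (ord_pred i)
      + det2 (v (ord_pred i)) (dual_vec (v i)) * eps v i).
  rewrite -[LHS]mul1r -(det2_dual pv) /eps ord_predK !det2E; ring.
by rewrite /a_coef E intrN intrD !intrM; field; rewrite e0 e1.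
Qed.

(** Shifting the index in the terms with [ord_pred i] makes each edge collect the dual vectors of
    both its ends. *)
Lemma sum_a_coef (K : fieldType) (d : nat) (v : 'I_d -> 'cV[int]_2) :
    (forall i, primitive (v i)) -> (forall i, (eps v i)%:~R != 0 :> K) ->
  \sum_(i < d) a_coef v K i =
  - \sum_(i < d) (det2 (v (ordS i)) (dual_vec (v i))
                  + det2 (v i) (dual_vec (v (ordS i))))%:~R / (eps v i)%:~R.
Proof.
move=> pv e0; under eq_bigr => i _ do rewrite a_coef_dual //.
rewrite sumrN; congr (- _); rewrite big_split /=.
rewrite [X in _ + X](reindex_inj (@ordS_inj d)) -big_split /=.
by apply: eq_bigr => i _; rewrite ordSK intrD mulrDl.
Qed.

Theorem theorem4 (R : realType) (d : nat) (v : 'I_d -> 'cV[int]_2)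
    (x y : 'I_d -> nat) (n : 'I_d -> seq int)
    (hd : (0 < d)%N)
    (v_primitive : forall i, primitive (v i))
    (eps_neq0 : forall i, eps v i != 0)
    (hx : forall i, is_x v i (x i))
    (hy : forall i, is_y v i (y i))
    (hn : forall i, is_hj_seq v i (x i) (n i)) :
  rotation_number R v =
  12^-1 * \sum_(i < d)
    ((3 * ((size (n i)).+1)%:R - \sum_(m <- n i) m%:~R)
       * ((eps v i)%:~R / `|(eps v i)%:~R|)
     + a_coef v R i
     - ((x i)%:R + (y i)%:R) / (eps v i)%:~R).
Proof.
have epsR i : (eps v i)%:~R != 0 :> R by rewrite intr_eq0.
under eq_bigr => i _ do rewrite addrAC.
rewrite big_split /= sum_a_coef // -sumrB rotation_number_side //.
(* The factor 3 is the one on the right-hand side of [edge_identity]. *)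
have -> : 4^-1 = 12^-1 * 3 :> R by field.
rewrite -mulrA mulr_sumr; congr (_ * _); apply: eq_bigr => i _.
have [xm _ /normalized_dvd xU] := hx i; have [ym /normalized_dvd yU] := hy i.
have m0 : (0 < `|eps v i|)%N by rewrite absz_gt0.
have [u hu] := xU m0; have [z hz] := yU m0; have [hn2 hn1] := hn i.
have epsE : eps v i = sgz (eps v i) * (absz (eps v i))%:Z by rewrite -intEsg.
have s1 : `|sgz (eps v i)| = 1 by rewrite normr_sgz eps_neq0.
have := edge_identity R s1 (v_primitive i) (v_primitive (ordS i)) epsE m0 xm ym hu hz hn2 hn1.
have -> : (sgz (eps v i))%:~R * (absz (eps v i))%:R = (eps v i)%:~R :> R.
  by rewrite {3}epsE intrM.
have -> : (eps v i)%:~R / `|(eps v i)%:~R| = (sgz (eps v i))%:~R :> R.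
  rewrite [X in X / _]numEsg mulfK ?normr_eq0 //.
  by rewrite sgrEz sgz_int.
by move=> ->; rewrite !intrM intrB intrM mulrA.
Qed.
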